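(* Let $\Delta$ be a simplicial complex of dimension $d$. If $\widetilde{ \beta }_d( \Delta; \mathbf{k})\neq 0$, then $\Delta$ admits a homology splitting over $\mathbf{k}$.
   Context: $\mathbf{k}$ is a field and $\widetilde{\beta}_k(\cdot;\mathbf{k})$ is the dimension of reduced homology over $\mathbf{k}$. A standard decomposition $\Delta=\Delta_1\cup\Delta_2$ is given by a partition $\mathcal{F}(\Delta)=\mathcal{F}_1 \sqcup \mathcal{F}_2$ of the facets, with $\Delta_i=\langle F : F\in\mathcal{F}_i\rangle$; it is a homology splitting over $\mathbf{k}$ if $\Delta_1\cap\Delta_2=\emptyset$ or if $\widetilde{\beta}_k(\Delta;\mathbf{k})=\widetilde{\beta}_k(\Delta_1;\mathbf{k})+\widetilde{\beta}_k(\Delta_2;\mathbf{k})+\widetilde{\beta}_{k-1}(\Delta_1\cap\Delta_2;\mathbf{k})$ for every $k\in\mathbb{N}$. $\Delta$ admits a homology splitting over $\mathbf{k}$ if some standard decomposition of $\Delta$ is a homology splitting over $\mathbf{k}$. *)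

(* Defs.v *)
From HB Require Import structures.
From mathcomp Require Import all_boot all_order all_algebra.

Set Implicit Arguments.
Unset Strict Implicit.
Unset Printing Implicit Defensive.

Import Order.TTheory GRing.Theory Num.Theory.
Local Open Scope ring_scope.

Section Complexes.
Variable V : finType.
Implicit Types (D : {set {set V}}) (F G : {set V}) (k : int).

(* The empty face belongs to every complex. Elements of V need not be
   vertices of D. *)
Definition simplicial_complex D : Prop :=
  set0 \in D /\ (forall F G, F \in D -> G \subset F -> G \in D).

Definition faces D k : {set {set V}} := [set F : {set V} in D | #|F|%:Z == k + 1].

Definition complex_dim D : int := (\max_(F in D) #|F|)%N%:Z - 1.

Definition facets D : {set {set V}} := [set F : {set V} | maxset [in D] F].

Definition generated (S : {set {set V}}) : {set {set V}} :=
  [set G : {set V} | [exists F in S, G \subset F]].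

Definition facet_partition D (S1 S2 : {set {set V}}) : Prop :=
  [/\ S1 != set0, S2 != set0, [disjoint S1 & S2] & S1 :|: S2 = facets D].

Lemma generated_complex (S : {set {set V}}) :
  S != set0 -> simplicial_complex (generated S).
Proof.
case/set0Pn=> F0 F0S; split.
  by rewrite inE; apply/exists_inP; exists F0; rewrite ?sub0set.
move=> F G; rewrite !inE => /exists_inP[H HS sFH] sGF.
by apply/exists_inP; exists H => //; apply: subset_trans sFH.
Qed.

Lemma setI_complex D1 D2 : simplicial_complex D1 -> simplicial_complex D2 ->
  simplicial_complex (D1 :&: D2).
Proof.
move=> [D10 D1s] [D20 D2s]; split; first by rewrite inE D10.
move=> F G; rewrite !inE => /andP[F1 F2] sGF.
by apply/andP; split; [apply: (D1s F) | apply: (D2s F)].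
Qed.

End Complexes.

Section ReducedHomology.
Variables (K : fieldType) (V : finType).
Implicit Types (D : {set {set V}}) (F G : {set V}) (k : int).

(* Chains of all degrees on the full simplex on V; every face is oriented by
   the order of its vertices in the enumeration of V. *)
Definition chain := {ffun {set V} -> K^o}.
HB.instance Definition _ := Vector.on chain.

Definition simplex F : chain := [ffun G => (G == F)%:R].

Definition position F (v : V) : nat :=
  #|[set u in F | (enum_rank u < enum_rank v)%N]|.

(* For a single vertex this is the augmentation: its boundary is the empty
   face. *)
Definition simplex_boundary F : chain :=
  \sum_(v in F) (-1) ^+ position F v *: simplex (F :\ v).

Definition boundary_fun (c : chain) : chain :=
  \sum_F (c F : K) *: simplex_boundary F.

Fact boundary_fun_linear : linear boundary_fun.
Proof.
move=> a b c; rewrite /boundary_fun scaler_sumr -big_split /=.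
by apply: eq_bigr => F _; rewrite !ffunE scalerDl scalerA.
Qed.
HB.instance Definition _ :=
  GRing.isLinear.Build K chain chain *:%R boundary_fun boundary_fun_linear.

Definition boundary : 'End(chain) := linfun boundary_fun.

Definition chains D k : {vspace chain} :=
  <<[seq simplex F | F in faces D k]>>%VS.

Definition cycles D k : {vspace chain} := (chains D k :&: lker boundary)%VS.

Definition boundaries D k : {vspace chain} := (boundary @: chains D (k + 1))%VS.

Lemma boundary_simplex F : boundary (simplex F) = simplex_boundary F.
Proof.
rewrite lfunE /= /boundary_fun (bigD1 F) //= big1 => [|G nGF].
  by rewrite addr0 ffunE eqxx scale1r.
by rewrite ffunE (negPf nGF) scale0r.
Qed.

Lemma boundary_boundary F : boundary (boundary (simplex F)) = 0.
Proof.
rewrite boundary_simplex linear_sum /=.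
pose T v u : chain := ((-1) ^+ position F v * (-1) ^+ position (F :\ v) u) *:
  simplex (F :\ v :\ u).
have -> : \sum_(v in F) boundary ((-1) ^+ position F v *: simplex (F :\ v)) =
    \sum_(v in F) \sum_(u in F | u != v) T v u.
  apply: eq_bigr => v vF; rewrite linearZ /= boundary_simplex scaler_sumr.
  by apply: eq_big => [u|u _]; rewrite ?in_setD1 1?andbC // scalerA.
pose lt (u v : V) := (enum_rank u < enum_rank v)%N.
have pos_gt v u : lt v u -> position F u = ((v \in F) + position (F :\ v) u)%N.
  move=> ltvu; rewrite /position (cardsD1 v) !inE [(_ < _)%N]ltvu andbT; congr (_ + _)%N.
  by apply: eq_card => w; rewrite !inE andbA.
have pos_lt v u : lt u v -> position (F :\ v) u = position F u.
  move=> ltuv; apply: eq_card => w; rewrite !inE.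
  by case: eqP => //= ->; rewrite (ltnNge (enum_rank v)) (ltnW ltuv) andbF.
have split_lt v : \sum_(u in F | u != v) T v u =
    \sum_(u in F | lt u v) T v u + \sum_(u in F | lt v u) T v u.
  rewrite (bigID (fun u => lt u v)) /=; congr (_ + _); apply: eq_bigl => u;
    rewrite -andbA; congr (_ && _); rewrite -(inj_eq enum_rank_inj) -val_eqE /lt;
    by case: ltngtP.
rewrite (eq_bigr _ (fun v _ => split_lt v)) big_split /= addrC.
rewrite (exchange_big_dep [in F]) /=; last by move=> ? ? ? /andP[].
rewrite -big_split big1 //= => u uF.
have -> : \sum_(i in F | (u \in F) && lt i u) T i u = \sum_(i in F | lt i u) T i u.
  by apply: eq_bigl => i; rewrite uF.
rewrite -big_split big1 //= => v /andP[vF ltvu].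
rewrite /T (pos_gt v u) // vF (pos_lt u v) //.
have -> : F :\ u :\ v = F :\ v :\ u by apply/setP=> w; rewrite !inE andbCA.
by rewrite -scalerDl exprS mulN1r !mulNr [X in X - _]mulrC subrr scale0r.
Qed.

Lemma boundaries_sub_cycles D k :
  simplicial_complex D -> (boundaries D k <= cycles D k)%VS.
Proof.
move=> [_ Ds]; rewrite /boundaries /chains limg_span; apply/span_subvP => c.
case/mapP=> _ /imageP[F + ->] ->; rewrite inE => /andP[FD /eqP cF].
rewrite memv_cap memv_ker boundary_boundary eqxx andbT boundary_simplex.
apply: memv_suml => v vF; apply/memvZ/memv_span/image_f.
have FvD : F :\ v \in D by apply: Ds FD _; apply: subD1set.
rewrite inE FvD /= -(inj_eq (addIr 1)) -cF.
by rewrite (cardsD1 v F) vF addrC.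
Qed.

(* Dimension of the quotient of cycles by boundaries: on a complex the
   subtraction is not truncated, by boundaries_sub_cycles. *)
Definition reduced_betti D k : nat := (\dim (cycles D k) - \dim (boundaries D k))%N.

(* Two nonempty complexes always share the empty face, so their intersection
   is "empty" when it has no other face. *)
Definition homology_splitting D (S1 S2 : {set {set V}}) : Prop :=
  let D1 := generated S1 in
  let D2 := generated S2 in
  facet_partition D S1 S2 /\
  (D1 :&: D2 \subset [set set0] \/
   forall k : nat,
     reduced_betti D k%:Z =
       (reduced_betti D1 k%:Z + reduced_betti D2 k%:Z
        + reduced_betti (D1 :&: D2) (k%:Z - 1))%N).

Definition admits_homology_splitting D : Prop :=
  exists S1 S2, homology_splitting D S1 S2.

End ReducedHomology.

(* Main.v *)
(* Let z be a nonzero d-cycle and F a face in its support. Then F is a facet,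
   and every ridge of F lies in another face of the support of z, so the facets
   other than F generate D minus F, which meets the simplex on F in the boundary
   of that simplex, a (d-1)-sphere. Exchanging F for z as a basis element of the
   d-chains shows that removing F lowers the d-th Betti number by one and changes
   no other. *)
Require Import Defs.
From mathcomp Require Import all_boot all_order all_algebra.
From mathcomp Require Import zify.

Set Implicit Arguments.
Unset Strict Implicit.
Unset Printing Implicit Defensive.

Import Order.TTheory GRing.Theory Num.Theory.
Local Open Scope ring_scope.

Section Splitting.
Variables (K : fieldType) (V : finType).
Implicit Types (D : {set {set V}}) (F G H : {set V}) (v : V) (k : int).
Implicit Type c : chain K V.

(** * Coefficients of boundaries and supports of chains *)

Lemma boundary_coef c G :
  boundary K V c G =
  \sum_(v | v \notin G) (-1) ^+ position (v |: G) v * c (v |: G).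
Proof.
rewrite lfunE /= /boundary_fun sum_ffunE.
transitivity (\sum_(F : {set V}) \sum_(v in F)
    c F * ((-1) ^+ position F v * (G == F :\ v)%:R) : K).
  apply: eq_bigr => F _; rewrite ffunE /simplex_boundary sum_ffunE scaler_sumr.
  by apply: eq_bigr => v _; rewrite !ffunE.
rewrite (exchange_big_dep predT) //= [RHS]big_mkcond /=; apply: eq_bigr => v _.
case: ifPn => vG; last first.
  rewrite big1 // => F vF; case: eqP => [GF|_]; last by rewrite !mulr0.
  by rewrite GF !inE eqxx in vG.
rewrite (bigD1 (v |: G)) ?setU11 //= big1 => [|F /andP[vF]].
  by rewrite setU1K // eqxx mulr1 addr0 mulrC.
case: (G =P _) => [->|_]; first by rewrite setD1K ?eqxx.
by rewrite !mulr0.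
Qed.

(** Membership in a span becomes a pointwise condition on the support; both directions expand [c] in
    the simplices on the faces. *)
Lemma chainsP D k c :
  reflect (forall G, c G != 0 -> G \in faces D k) (c \in chains K D k).
Proof.
apply: (iffP idP) => [|supp_c].
  rewrite /chains => c_span G; apply: contraNT => GD; apply/eqP.
  rewrite (coord_span (X := in_tuple _) c_span) sum_ffunE big1 // => i _.
  have /mapP[F] : (in_tuple [seq simplex K F | F in faces D k])`_i
      \in [seq simplex K F | F in faces D k] by exact: mem_nth.
  rewrite mem_enum => FD ->; rewrite !ffunE; case: eqP => [GF|_]; last exact: scaler0.
  by rewrite GF FD in GD.
have -> : c = \sum_(G in faces D k) (c G : K) *: simplex K G.
  apply/ffunP => G; rewrite sum_ffunE.
  case: (boolP (G \in faces D k)) => GD.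
    rewrite (bigD1 G) //= big1 => [|F /andP[_ FG]].
      by rewrite !ffunE eqxx addr0 [RHS]mulr1.
    by rewrite !ffunE eq_sym (negPf FG) scaler0.
  rewrite big1 => [|F FD]; first by apply/eqP; apply: contraNT GD; apply: supp_c.
  rewrite !ffunE; case: eqP => [GF|_]; last exact: scaler0.
  by rewrite GF FD in GD.
by apply: memv_suml => G GD; apply/memvZ/memv_span/image_f.
Qed.

(* For [G] without [v], the only face over [G] containing [v] is [v |: G], so
   the boundary of such a chain has a single term at [G]. *)
Lemma boundary_star c v G : (forall H, v \notin H -> c H = 0) -> v \notin G ->
  boundary K V c G = (-1) ^+ position (v |: G) v * c (v |: G).
Proof.
move=> cv vG; rewrite boundary_coef (bigD1 v) //= big1 ?addr0 // => u /andP[_ uv].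
by rewrite cv ?mulr0 // !inE negb_or eq_sym uv.
Qed.

(** For [v \in G], the value [c G] is up to sign the coefficient of the boundary at [G :\ v], so the
    boundary determines [c]. *)
Lemma star_cycle0 c v : (forall H, v \notin H -> c H = 0) ->
  boundary K V c = 0 -> c = 0.
Proof.
move=> cv bc; apply/ffunP => G; rewrite ffunE.
case: (boolP (v \in G)) => [vG|/cv //].
have vGv : v \notin G :\ v by rewrite !inE eqxx.
have := boundary_star cv vGv; rewrite bc ffunE setD1K // => /esym/eqP.
by rewrite mulf_eq0 signr_eq0 => /eqP.
Qed.

Lemma boundary2 c : boundary K V (boundary K V c) = 0.
Proof.
rewrite [boundary K V c]lfunE /= linear_sum big1 // => F _.
by rewrite linearZ /= -boundary_simplex boundary_boundary scaler0.
Qed.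

(** * Homology of a simplex and of its boundary sphere *)

Lemma powerset_complex F : simplicial_complex (powerset F).
Proof.
split=> [|A B]; rewrite !powersetE ?sub0set // => AF BA.
exact: subset_trans AF.
Qed.

(** A simplex is a cone with apex any vertex [v] of [F], hence acyclic. For empty [F], the empty
    face would be a cycle in degree -1 that bounds nothing. *)
Lemma powerset_cycles F k : F != set0 ->
  cycles K (powerset F) k = boundaries K (powerset F) k.
Proof.
case/set0Pn=> v vF; apply/eqP; rewrite eqEsubv boundaries_sub_cycles ?andbT;
  last exact: powerset_complex.
apply/subvP => c /memv_capP[/chainsP c_supp]; rewrite memv_ker => /eqP bc.
(* The boundary of b agrees with c on the faces without v, so c minus it is a
   cycle supported on the star of v. *)
pose b : chain K V := [ffun H : {set V} => if v \in H then
  (-1) ^+ position H v * c (H :\ v) else 0].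
have bv H : v \notin H -> b H = 0 by move=> vH; rewrite ffunE (negPf vH).
have cb : c - boundary K V b = 0.
  apply: (@star_cycle0 _ v); last by rewrite linearB /= bc boundary2 subrr.
  move=> H vH; rewrite !ffunE (boundary_star bv vH) ffunE setU11 setU1K //.
  by rewrite mulrA -expr2 sqrr_sign mul1r subrr.
move/eqP: cb; rewrite subr_eq0 => /eqP ->; apply/memv_img/chainsP => H.
rewrite ffunE; case: ifP => [vH|]; last by rewrite eqxx.
rewrite mulf_eq0 signr_eq0 /= => /c_supp; rewrite !inE.
case/andP=> HF /eqP cH; apply/andP; split.
  by rewrite -(setD1K vH) subUset sub1set vF.
by rewrite (cardsD1 v H) vH; lia.
Qed.

Lemma powerset_betti F k : F != set0 -> reduced_betti K (powerset F) k = 0%N.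
Proof. by move=> F0; rewrite /reduced_betti powerset_cycles // subnn. Qed.

Lemma faces_setD1 D F k : F \notin faces D k -> faces (D :\ F) k = faces D k.
Proof.
move=> FD; apply/setP => G; rewrite !inE.
by case: eqP => //= ->; move: FD; rewrite inE => /negPf.
Qed.

Lemma chains_setD1 D F k : F \notin faces D k -> chains K (D :\ F) k = chains K D k.
Proof. by move=> FD; rewrite /chains faces_setD1. Qed.

Lemma faces_powerset F k : #|F|%:Z = k + 1 -> faces (powerset F) k = [set F].
Proof.
move=> Fk; apply/setP => G; rewrite !inE.
apply/andP/eqP => [[GF /eqP Gk]|->]; last by rewrite Fk eqxx subxx.
by apply/eqP; rewrite eqEcard GF; lia.
Qed.

Lemma chains_powerset_top F k : #|F|%:Z = k + 1 ->
  chains K (powerset F) k = <[simplex K F]>%VS.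
Proof.
move=> Fk; rewrite /chains faces_powerset // /image_mem enum_set1 /=.
exact: span_seq1.
Qed.

Lemma chains_simplex_boundary_top F k : #|F|%:Z = k + 1 ->
  chains K (powerset F :\ F) k = 0%VS.
Proof.
move=> Fk; apply/eqP; rewrite -subv0; apply/subvP => c /chainsP c_supp.
rewrite memv0; apply/eqP/ffunP => G; rewrite [RHS]ffunE; apply/eqP.
apply: contraTT (isT) => /c_supp; rewrite 3!inE -andbA => /and3P[GF GP Gk].
have : G \in faces (powerset F) k by rewrite inE GP.
by rewrite faces_powerset // inE (negPf GF).
Qed.

(** A sphere of dimension [#|F| - 2]: in that degree its cycles are the boundaries of the full
    simplex, the line spanned by the boundary of [F], and none of them bounds once [F] is gone. *)
Lemma simplex_boundary_betti F k : F != set0 ->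
  reduced_betti K (powerset F :\ F) k = (#|F|%:Z == k + 1 + 1).
Proof.
move=> F0; rewrite /reduced_betti /cycles /boundaries.
case: eqP => [Fk|Fk].
  rewrite (chains_simplex_boundary_top Fk) limg0 dimv0 subn0.
  rewrite chains_setD1; last by rewrite !inE subxx; lia.
  rewrite -/(cycles _ _ _) powerset_cycles // /boundaries chains_powerset_top //.
  rewrite limg_line dim_vline; case: eqP => // bF.
  case/set0Pn: F0 => v vF.
  (* [simplex K F] is supported on the star of [v], so a zero boundary would make it vanish. *)
  have /ffunP/(_ F) : simplex K F = 0.
    apply: (@star_cycle0 _ v) bF => H; rewrite ffunE.
    by case: eqP => // ->; rewrite vF.
  by rewrite !ffunE eqxx => /eqP; rewrite oner_eq0.
(* In the degree of [F] itself no chains are left; in the remaining degrees cycles and boundaries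
   are those of the full simplex. *)
have [Fk1|Fk1] := eqVneq #|F|%:Z (k + 1).
  by rewrite chains_simplex_boundary_top // cap0v dimv0.
rewrite !chains_setD1 ?inE ?subxx //; last exact/eqP.
exact: powerset_betti.
Qed.

(** * Removing a face in the support of a cycle *)

(** Since [z F] is nonzero, the [m]-chains of [D] are those of [D :\ F] plus the line of [z]. As [z]
    is a cycle, this adds one to the dimension of the [m]-cycles and nothing to the boundaries in
    degree [m - 1]. *)
Lemma betti_setD1 D F m k (z : chain K V) : simplicial_complex (D :\ F) ->
  z \in cycles K D m -> z F != 0 ->
  reduced_betti K D k = (reduced_betti K (D :\ F) k + (#|F|%:Z == k + 1)%R)%N.
Proof.
move=> cDF /memv_capP[zD zker] zF.
have /setIdP[FD /eqP Fm] : F \in faces D m by apply/chainsP: zF.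
have chainsm : chains K D m = (chains K (D :\ F) m + <[z]>)%VS.
  apply/eqP; rewrite eqEsubv subv_add -memvE zD andbT; apply/andP; split.
    apply/subvP => c /chainsP cD; apply/memv_addP.
    (* This multiple of [z] cancels the coefficient at [F]. *)
    exists (c - (c F / z F : K) *: z).
      apply/chainsP => G; have [->|GF] := eqVneq G F.
        by rewrite !ffunE [_ *: _]divfK ?subrr ?eqxx.
      rewrite !inE GF /= => nz.
      have : (c G != 0) || (z G != 0).
        apply: contraNT nz; rewrite negb_or !negbK !ffunE => /andP[/eqP-> /eqP->].
        by rewrite scaler0 subrr.
      move/chainsP in zD.
      by case/orP => [/cD|/zD]; rewrite inE.
    by exists ((c F / z F : K) *: z); rewrite ?memvZ ?memv_line // subrK.
  apply/subvP => c /chainsP cD; apply/chainsP => G /cD.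
  by rewrite !inE -andbA => /and3P[_ -> ->].
have [km|km] := eqVneq k m.
  subst m; rewrite Fm eqxx addn1 /reduced_betti.
  (* Moving the successor inside the truncated subtraction requires the boundaries of [D :\ F] to be
     cycles. *)
  rewrite -subSn; last exact/dimvS/boundaries_sub_cycles.
  congr (_ - _)%N; last by rewrite /boundaries chains_setD1 // inE FD Fm; lia.
  (* As [z] lies in the kernel, the modular law pulls its line out of the intersection; the sum is
     direct because chains on [D :\ F] vanish at [F]. *)
  rewrite /cycles chainsm [X in (X :&: _)%VS]addvC -vspace_modl -?memvE // addvC.
  rewrite dimv_disjoint_sum ?dim_vline.
    suff -> : z != 0 by rewrite addn1.
    by apply: contraNneq zF => ->; rewrite ffunE.
  apply/eqP; rewrite -subv0; apply/subvP => c /memv_capP[/memv_capP[/chainsP cD _]].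
  case/vlineP => a ca; rewrite memv0 ca.
  have /eqP : c F = 0.
    by apply/eqP; apply: contraTT isT => /cD; rewrite !inE eqxx.
  by rewrite ca ffunE [_ *: _ == _]mulf_eq0 (negPf zF) orbF => /eqP->; rewrite scale0r.
have -> : (#|F|%:Z == k + 1) = false by rewrite Fm; lia.
rewrite addn0 /reduced_betti /cycles chains_setD1; last by rewrite inE FD Fm; lia.
congr (_ - \dim _)%N; rewrite /boundaries.
have [km1|km1] := eqVneq (k + 1) m.
  rewrite km1 chainsm limgD limg_line; move: zker; rewrite memv_ker => /eqP->.
  by rewrite (_ : <[0]>%VS = 0%VS) ?addv0 //; apply/eqP; rewrite -dimv_eq0 dim_vline eqxx.
by rewrite chains_setD1 // inE FD Fm; lia.
Qed.

(* Otherwise [F :\ v] would have nonzero coefficient in the boundary. *)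
Lemma cycle_ridge D m (z : chain K V) F v : z \in cycles K D m -> z F != 0 ->
  v \in F -> exists2 H, (H != F) && (F :\ v \subset H) & z H != 0.
Proof.
case/memv_capP=> _; rewrite memv_ker => /eqP bz zF vF.
case: (pickP [pred H | [&& H != F, F :\ v \subset H & z H != 0]]) => [H|no_H].
  by case/and3P=> HF FH zH; exists H; rewrite ?HF.
have := boundary_coef z (F :\ v); rewrite bz ffunE.
rewrite (bigD1 v) ?inE ?eqxx //= setD1K // big1 => [/esym/eqP|u /andP[uF uv]].
  by rewrite addr0 mulf_eq0 signr_eq0 (negPf zF).
have := no_H (u |: F :\ v); rewrite /= subsetUr /=.
have -> /= : u |: F :\ v != F.
  by apply: contraNneq uF => uF; rewrite !inE uv -uF setU11.
by move/negbFE/eqP->; rewrite mulr0.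
Qed.

(** * Facets of top dimension and what they generate *)

Lemma card_face_leq D F (d : nat) : complex_dim D = d%:Z -> F \in D -> (#|F| <= d.+1)%N.
Proof.
rewrite /complex_dim => dimD FD.
have := @leq_bigmax_cond _ [in D] (fun F => #|F|) F FD; lia.
Qed.

Lemma facet_of_top D F (d : nat) : complex_dim D = d%:Z ->
  F \in faces D d%:Z -> F \in facets D.
Proof.
move=> dimD; rewrite !inE => /andP[FD /eqP Fd]; apply/maxsetP; split=> // G GD FG.
apply/esym/eqP; rewrite eqEcard FG; have := card_face_leq dimD GD; lia.
Qed.

(** No other facet contains [F]. Conversely, a face that extends only to the facet [F] misses some
    vertex [v] of [F], so it lies in the ridge [F :\ v], hence in another face of the support of
    [z], again a facet. *)
Lemma generated_facets D F (d : nat) (z : chain K V) :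
  simplicial_complex D -> complex_dim D = d%:Z -> z \in cycles K D d%:Z -> z F != 0 ->
  generated (facets D :\ F) = D :\ F.
Proof.
move=> [_ Ds] dimD zD zF; have /memv_capP[/chainsP z_supp _] := zD.
have /facet_of_top-/(_ dimD) := z_supp _ zF; rewrite inE => /maxsetP[FD Fmax].
apply/setP => G; rewrite !inE; apply/exists_inP/andP.
  case=> H; rewrite !inE => /andP[HF /maxsetP[HD _]] GH.
  split; last exact: Ds GH.
  by apply: contraNneq HF => GF; rewrite (Fmax H) // -GF.
case=> GF GD; have [H Hmax GH] := maxset_exists (P := [in D]) GD.
have [HF|HF] := eqVneq H F; last by exists H; rewrite // !inE HF.
rewrite {}HF in GH.
have [v vF vG] : exists2 v, v \in F & v \notin G.
  by apply/subsetPn; apply: contraNN GF => FG; rewrite eqEsubset GH.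
have [H' /andP[H'F FH'] /z_supp H'D] := cycle_ridge zD zF vF.
exists H'; first by rewrite in_setD1 H'F (facet_of_top dimD).
by apply: subset_trans FH'; rewrite subsetD1 GH.
Qed.

End Splitting.

Theorem theorem4p8 (K : fieldType) (V : finType) (D : {set {set V}}) (d : nat)
    (complexD : simplicial_complex D) (dimD : complex_dim D = d%:Z)
    (betti_neq0 : reduced_betti K D d%:Z <> 0%N) :
  admits_homology_splitting K D.
Proof.
(* [vpick] returns a nonzero vector unless the space is zero, which the Betti number excludes. *)
pose z : chain K V := vpick (cycles K D d%:Z).
have zD : z \in cycles K D d%:Z by exact: memv_pick.
have [F zF] : exists F, z F != 0.
  apply/existsP; apply: contra_notT betti_neq0; rewrite negb_exists => /forallP z0.
  have /eqP : z = 0 by apply/ffunP => G; rewrite ffunE; apply/eqP; rewrite -[_ == _]negbK.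
  by rewrite vpick0 /reduced_betti => /eqP->; rewrite dimv0.
have FDd : F \in faces D d%:Z by case/memv_capP: zD => /chainsP + _; apply.
have Ffacet := facet_of_top dimD FDd.
have genD := generated_facets complexD dimD zD zF.
move: FDd; rewrite inE => /andP[FD /eqP Fd].
have F0 : F != set0 by rewrite -card_gt0; lia.
have [v vF] := set0Pn _ F0.
have D_F0 : set0 \in D :\ F by rewrite !inE eq_sym F0; case: complexD.
(* The empty face of [D :\ F] must lie in some generator, so [F] is not the only facet. *)
have S2 : facets D :\ F != set0.
  by move: D_F0; rewrite -genD inE => /exists_inP[H HS _]; apply/set0Pn; exists H.
have genF : generated [set F] = powerset F.
  apply/setP => G; rewrite !inE; apply/exists_inP/idP => [[H]|GF].
    by rewrite inE => /eqP->.
  by exists F; rewrite ?set11.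
exists [set F], (facets D :\ F); split.
  split=> //; first by apply/set0Pn; exists F; rewrite set11.
    by rewrite disjoints1 !inE eqxx.
  exact: setD1K.
right=> k; rewrite genD genF.
have -> : powerset F :&: (D :\ F) = powerset F :\ F.
  apply/setP => G; rewrite !inE; case: (boolP (G \subset F)) => GF; last by rewrite andbF.
  by rewrite (complexD.2 _ _ FD GF) !andbT.
(* In degree [k - 1] the sphere contributes one exactly when [k] is the dimension of [F], which
   matches the drop caused by removing [F]. *)
rewrite powerset_betti // simplex_boundary_betti // subrK add0n.
by apply: betti_setD1 zD zF; rewrite -genD; apply: generated_complex.
Qed.
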